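(* Let $\Gamma$ and $G$ be finite groups and let $\varphi\colon\Gamma\to G$ be a homomorphism such that $G=\langle\varphi(\Gamma)^G\rangle$ (the normal closure of $\varphi(\Gamma)$ in $G$). Then the normal closures tower $\cdots\to\Gamma_{k+1}\xrightarrow{\overline{\varphi_k}}\Gamma_k\to\cdots\to\Gamma_2\xrightarrow{\overline{\varphi_1}}\Gamma_1=G$ of $\varphi$ terminates after a finite number of steps; that is, there is $k\ge 1$ such that $\overline{\varphi_i}\colon\Gamma_{i+1}\to\Gamma_i$ is an isomorphism for all $i\ge k$.
   Context: Notation: $h^g=g^{-1}hg$ in a group. A normal map (crossed module) is a group homomorphism $n\colon M\to G$ together with a right action of $G$ on $M$ by automorphisms, $(a,g)\mapsto a^g$ (the normal structure), such that (NM1) $n(a^g)=n(a)^g$ for all $a\in M$, $g\in G$; (NM2) $a^{n(b)}=a^b=b^{-1}ab$ for all $a,b\in M$. A normal morphism over $G$ from $n_1\colon M_1\to G$ to $n_2\colon M_2\to G$ is a homomorphism $\mu\colon M_1\to M_2$ with $n_2(\mu(a))=n_1(a)$ and $\mu(a^g)=\mu(a)^g$ for all $a\in M_1$, $g\in G$. The free normal closure of a homomorphism $\varphi\colon\Gamma\to G$ is a factorization $\Gamma\xrightarrow{c_\varphi}\Gamma^\varphi\xrightarrow{\overline\varphi}G$ of $\varphi$ (so $\overline\varphi(c_\varphi(\gamma))=\varphi(\gamma)$) with $\overline\varphi$ a normal map, such that for every factorization $\Gamma\xrightarrow{\psi}M\xrightarrow{n}G$ of $\varphi$ with $n$ a normal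 map there is a unique normal morphism $\overline\psi\colon\Gamma^\varphi\to M$ over $G$ with $\overline\psi(c_\varphi(\gamma))=\psi(\gamma)$ for all $\gamma\in\Gamma$. It exists and is unique up to isomorphism of normal maps over $G$. The normal closures tower of $\varphi$ is defined by $\varphi_1:=\varphi$, $\Gamma_1:=G$ and inductively, for $i\ge1$, $\Gamma_{i+1}:=\Gamma^{\varphi_i}$, $\varphi_{i+1}:=c_{\varphi_i}\colon\Gamma\to\Gamma_{i+1}$, with the normal maps $\overline{\varphi_i}\colon\Gamma_{i+1}\to\Gamma_i$ satisfying $\overline{\varphi_i}(\varphi_{i+1}(\gamma))=\varphi_i(\gamma)$. *)

(* Defs.v *)
From HB Require Import structures.
From mathcomp Require Import all_boot all_fingroup.

Set Implicit Arguments.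
Unset Strict Implicit.
Unset Printing Implicit Defensive.

Import GroupScope.

(* Groups are [groupType]s, which may be infinite; the finite groups are the
   [finGroupType]s. A multiplicative map between groups is automatically a
   group homomorphism. *)

(* That [act^~ g] is an automorphism of [M] follows from the first three
   fields. *)
Record is_normal_map (M G : groupType) (n : {multiplicative M -> G})
    (act : M -> G -> M) : Prop := IsNormalMap {
  nm_act1 : forall a, act a 1 = a;
  nm_actM : forall a g h, act a (g * h) = act (act a g) h;
  nm_actMl : forall a b g, act (a * b) g = act a g * act b g;
  nm_NM1 : forall a g, n (act a g) = n a ^ g;
  nm_NM2 : forall a b, act a (n b) = a ^ b }.

Definition is_normal_morphism (M1 M2 G : groupType)
    (n1 : {multiplicative M1 -> G}) (act1 : M1 -> G -> M1)
    (n2 : {multiplicative M2 -> G}) (act2 : M2 -> G -> M2)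
    (mu : {multiplicative M1 -> M2}) : Prop :=
  (forall a, n2 (mu a) = n1 a) /\
  (forall a g, mu (act1 a g) = act2 (mu a) g).

Record is_free_normal_closure (Gamma G C : groupType)
    (phi : {multiplicative Gamma -> G}) (c : {multiplicative Gamma -> C})
    (phibar : {multiplicative C -> G}) (act : C -> G -> C) : Prop :=
  IsFreeNormalClosure {
  fnc_normal : is_normal_map phibar act;
  fnc_factor : forall x, phibar (c x) = phi x;
  fnc_univ : forall (M : groupType) (psi : {multiplicative Gamma -> M})
      (n : {multiplicative M -> G}) (actM : M -> G -> M),
    is_normal_map n actM -> (forall x, n (psi x) = phi x) ->
    exists psibar : {multiplicative C -> M},
      [/\ is_normal_morphism phibar act n actM psibar,
          forall x, psibar (c x) = psi x
        & forall psi' : {multiplicative C -> M},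
            is_normal_morphism phibar act n actM psi' ->
            (forall x, psi' (c x) = psi x) -> psi' =1 psibar] }.

(* The groups of a tower and the maps from [Gamma] to them are indexed from 0:
   index [i] stands for Gamma_(i+1), phi_(i+1), and index 0 for [G], [phi].
   Splitting off index 0 makes Gamma_1 = G hold by computation. *)
Definition tower_group (G : groupType) (N : nat -> groupType) (i : nat) :
    groupType :=
  if i is j.+1 then N j else G.

Definition tower_map (Gamma G : groupType) (phi : {multiplicative Gamma -> G})
    (N : nat -> groupType) (c : forall j, {multiplicative Gamma -> N j})
    (i : nat) : {multiplicative Gamma -> tower_group G N i} :=
  match i with
  | 0 => phi
  | j.+1 => c j
  end.

(* Free normal closures are unique only up to isomorphism, so a tower is given
   by any choice of one at each stage: stage [i] is a free normal closure
   [Gamma -> tower_group i.+1 -> tower_group i] of [tower_map i]. *)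
Record normal_closures_tower (Gamma G : groupType)
    (phi : {multiplicative Gamma -> G}) := NormalClosuresTower {
  nct_group : nat -> groupType;
  nct_map : forall i, {multiplicative Gamma -> nct_group i};
  nct_bar : forall i, {multiplicative nct_group i -> tower_group G nct_group i};
  nct_act : forall i,
    nct_group i -> tower_group G nct_group i -> nct_group i;
  nct_closure : forall i,
    is_free_normal_closure (tower_map phi nct_map i) (nct_map i)
      (nct_bar i) (@nct_act i) }.

(* Main.v *)
(* Every map of the tower is a central extension, and by uniqueness in the
   universal property the free normal closure of a map Gamma -> H is generated by
   the translates of the image of Gamma under the action of H. When H is finite
   they form a finite set of torsion elements closed under conjugation, so by
   Dietzmann's argument the closure is finite; moreover, every Gamma_i is the
   normal closure of the image of Gamma, and all tower maps are surjective.
   It remains to bound the orders |Gamma_i| uniformly. The kernel K of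
   Gamma_i -> G is an iterated central extension, so elements of K commute with
   all elements of Gamma_i of coprime order. Fix a prime p, and factor out the
   elements of K of order prime to p, so that K is a p-group. The residual
   R = O^p(Gamma_i) then centralizes K, and K :&: R lies in R', which Schur's
   theorem bounds in terms of |R : K :&: R| <= |G|. The p-group Gamma_i / R is
   normally generated by an image of Gamma, hence equal to it. So the p-part of
   |Gamma_i| is at most some B depending on |Gamma| and |G| only; in particular
   all prime divisors of |Gamma_i| are at most B, and |Gamma_i| <= B ^ (B + 1). *)

Require Import Defs.
From HB Require Import structures.
From Stdlib Require Import Classical.
From mathcomp Require Import all_boot all_fingroup all_solvable.

Set Implicit Arguments.
Unset Strict Implicit.
Unset Printing Implicit Defensive.

Import GroupScope.

(** * Finite conjugation-closed generating sets *)

(** Induction on the alphabet: a letter occurring at most [n] times is filtered out, which shortens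
    the word by at most [n]. *)
Lemma pigeonhole_count (T : eqType) (S w : seq T) n :
    {subset w <= S} -> n * size S < size w ->
  exists2 s, s \in S & n < count_mem s w.
Proof.
elim: S w => [|s S IHS] w sWS ltw.
  by case: w sWS ltw => [|y w sWS _] //; have := sWS y (mem_head y w).
have [lt_n | le_n] := ltnP n (count_mem s w).
  by exists s; rewrite ?mem_head.
have [||t St ltt] := IHS (filter (predC1 s) w).
- move=> t; rewrite mem_filter => /andP[/= nts /sWS].
  by rewrite inE (negPf nts).
- rewrite size_filter -(leq_add2l (count_mem s w)) count_predC.
  by apply: leq_trans ltw; rewrite addnS ltnS mulnS leq_add2r.
exists t; first by rewrite inE St orbT.
apply: leq_trans ltt _; rewrite count_filter; apply: sub_count => x /=.
by case/andP.
Qed.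

Section Words.
Variable H : groupType.
Implicit Types (S w : seq H) (x y : H) (k n : nat).

(** A sequence with repetitions, because [H] is not known to be finite; its length serves as a bound
    on the number of products. *)
Fixpoint word_products S k : seq H :=
  if k is k'.+1 then
    word_products S k' ++ [seq s * x | s <- S, x <- word_products S k']
  else [:: 1].

Lemma size_word_products S k : size (word_products S k) = ((size S).+1 ^ k)%N.
Proof.
elim: k => //= k IHk.
by rewrite size_cat size_allpairs IHk expnS mulSn.
Qed.

Lemma mem_word_products S k w :
  {subset w <= S} -> size w <= k -> \prod_(y <- w) y \in word_products S k.
Proof.
elim: k w => [|k IHk] [|y w] //= sWS; rewrite ?big_nil ?mem_head // mem_cat.
  by move=> _; rewrite -(big_nil 1%g mul predT id) IHk.
move=> ltwk; apply/orP; right; rewrite big_cons; apply: allpairs_f.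
  by apply: sWS; rewrite mem_head.
by apply: IHk => // z zw; apply: sWS; rewrite inE zw orbT.
Qed.

Lemma word_productsP S k x :
  x \in word_products S k -> exists2 w, {subset w <= S} & x = \prod_(y <- w) y.
Proof.
elim: k x => [|k IHk] x /=.
  by rewrite inE => /eqP ->; exists [::]; rewrite ?big_nil.
rewrite mem_cat => /orP[/IHk // | /allpairsP[[s y] /= [Ss Ty ->]]].
have [w sWS ->] := IHk y Ty; exists (s :: w); last by rewrite big_cons.
by move=> z; rewrite inE => /predU1P[-> | /sWS].
Qed.

(* Collect [k] occurrences of [s] at the front, conjugating what they pass. *)
Lemma collect_letter S w s k :
    {in S &, forall x y, x ^ y \in S} -> {subset w <= S} -> s \in S ->
    k <= count_mem s w ->
  exists w', [/\ {subset w' <= S}, (size w' + k)%N = size w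
             & \prod_(y <- w) y = s ^+ k * \prod_(y <- w') y].
Proof.
move=> SJ + Ss; elim: w k => [|y w IHw] [|k] sWS lekw.
- by exists [::]; rewrite mul1g.
- by [].
- by exists (y :: w); rewrite addn0 mul1g.
have sWS' : {subset w <= S} by move=> z zw; apply: sWS; rewrite inE zw orbT.
have Sy : y \in S by apply: sWS; rewrite mem_head.
have [eys | neys] := eqVneq y s.
  move: lekw; rewrite /= eys eqxx => lekw.
  have [w' [sW'S <- prodw]] := IHw k sWS' lekw.
  by exists w'; rewrite addnS big_cons prodw mulgA -expgS.
move: lekw; rewrite /= (negPf neys) add0n => lekw.
have [w' [sW'S <- prodw]] := IHw k.+1 sWS' lekw.
exists (y ^ (s ^+ k.+1) :: w'); split=> //.
  move=> z; rewrite inE => /predU1P[-> | /sW'S //].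
  elim: k.+1 => [|j IHj]; first by rewrite conjg1.
  by rewrite expgSr conjgM SJ.
by rewrite !big_cons prodw !mulgA mulgV mul1g.
Qed.

(* Dietzmann's argument: a word longer than [n * size S] repeats some letter
   [n] times, and then can be shortened. *)
Lemma Dietzmann_shorten S n w :
    {in S &, forall x y, x ^ y \in S} ->
    (forall s, s \in S -> exists v,
       [/\ {subset v <= S}, size v < n & \prod_(y <- v) y = s ^+ n]) ->
    {subset w <= S} ->
  exists w', [/\ {subset w' <= S}, size w' <= n * size S
             & \prod_(y <- w') y = \prod_(y <- w) y].
Proof.
move=> SJ Sn; have [m] := ubnP (size w).
elim: m w => // m IHm w /ltnSE-lewm sWS.
have [lew | ltw] := leqP (size w) (n * size S); first by exists w.
have [s Ss ltns] := pigeonhole_count sWS ltw.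
have [w1 [sW1S sz1 prodw]] := collect_letter SJ sWS Ss (ltnW ltns).
have [v [sVS ltvn prodv]] := Sn s Ss.
have [||w' [sW'S szw' prodw']] := IHm (v ++ w1).
- by rewrite size_cat; apply: leq_trans lewm; rewrite -sz1 addnC ltn_add2l.
- by move=> z; rewrite mem_cat => /orP[/sVS | /sW1S].
by exists w'; split=> //; rewrite prodw' big_cat prodw prodv.
Qed.
End Words.

(** * Normal maps and free normal closures *)

Section GroupMorphisms.
Variables (G H : groupType) (f : {multiplicative G -> H}).

Lemma multiplicative1 : f 1 = 1.
Proof. by apply: (mulgI (f 1)); rewrite -gmulfM !mulg1. Qed.

(** Bundles [f] with the proof of [f 1 = 1], to make the general facts on group morphisms
    applicable. *)
Definition group_morphism : UMagmaMorphism.type G H :=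
  HB.pack (f : G -> H) (isMultiplicative.Build G H f (@gmulfM _ _ f))
    (Multiplicative_isUMagmaMorphism.Build G H f multiplicative1).

Lemma multiplicativeX k : {morph f : x / x ^+ k}.
Proof. exact: (gmulfXn group_morphism). Qed.

Lemma multiplicativeV : {morph f : x / x^-1}.
Proof. exact: (gmulfV group_morphism). Qed.

Lemma multiplicativeR : {morph f : x y / [~ x, y]}.
Proof. exact: (gmulfR group_morphism). Qed.

Lemma multiplicative_prod I (r : seq I) (F : I -> G) :
  f (\prod_(i <- r) F i) = \prod_(i <- r) f (F i).
Proof. exact: (gmulf_prod group_morphism). Qed.
End GroupMorphisms.

Lemma expg_coprime_eq1 (H : groupType) (a : H) k l :
  coprime k l -> a ^+ k = 1 -> a ^+ l = 1 -> a = 1.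
Proof.
have [-> | k_gt0] := posnP k; first by rewrite /coprime gcd0n => /eqP->.
case: (egcdnP l k_gt0) => u v /= uk _ /eqP co_kl ak1 al1.
have: a ^+ (u * k) = 1 by rewrite mulnC expgnA ak1 expg1n.
by rewrite uk co_kl expgnDr mulnC expgnA al1 expg1n mul1g.
Qed.

Section SubgroupType.
Variables (C : groupType) (S : {pred C}) (closedS : group_closed S).

(** The vacuous [let] makes the closure proof a parameter of the type, so that the subgroup
    structure can be attached to it. *)
Definition subgroup_type := let _ := closedS in {x : C | x \in S}.
HB.instance Definition _ := SubChoice.on subgroup_type.
HB.instance Definition _ :=
  SubChoice_isSubGroup.Build C [in S] subgroup_type closedS.
End SubgroupType.

Section NormalMaps.
Variables (M G : groupType) (n : {multiplicative M -> G}) (act : M -> G -> M).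
Hypothesis nm : is_normal_map n act.

Lemma act1g g : act 1 g = 1.
Proof. by apply: (mulgI (act 1 g)); rewrite -(nm_actMl nm) !mulg1. Qed.

Lemma actVg a g : act a^-1 g = (act a g)^-1.
Proof. by apply: (mulgI (act a g)); rewrite -(nm_actMl nm) !mulgV act1g. Qed.

Lemma actXg a g k : act (a ^+ k) g = act a g ^+ k.
Proof. by elim: k => [|k IHk]; rewrite ?act1g // !expgS (nm_actMl nm) IHk. Qed.

Lemma act_prodg I (r : seq I) (F : I -> M) g :
  act (\prod_(i <- r) F i) g = \prod_(i <- r) act (F i) g.
Proof.
elim: r => [|i r IHr]; first by rewrite !big_nil act1g.
by rewrite !big_cons (nm_actMl nm) IHr.
Qed.

(** By [nm_NM2] and [nm_NM1], conjugation by [act b h] is the action of [n b ^ h]. Hence translates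
    of the image of [Gamma] are closed under conjugation. *)
Lemma act_conjg a b g h : act a g ^ act b h = act a (g * n b ^ h).
Proof. by rewrite -(nm_NM2 nm) (nm_NM1 nm) (nm_actM nm). Qed.

(** Conjugation by [a] is the action of [n a], which is trivial here. *)
Lemma normal_map_central_ker a b : n a = 1 -> commute a b.
Proof.
move=> na1; apply/commute_sym/commgP/conjg_fixP.
by rewrite -(nm_NM2 nm) na1 (nm_act1 nm).
Qed.
End NormalMaps.

Section FreeNormalClosure.
Variables (Gamma G C : groupType) (phi : {multiplicative Gamma -> G}).
Variables (c : {multiplicative Gamma -> C}) (n : {multiplicative C -> G}).
Variable act : C -> G -> C.
Hypothesis fnc : is_free_normal_closure phi c n act.
Let nm := fnc_normal fnc.

(* The subgroup [S] is itself a normal map over [G] through which [phi]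
   factors; the retraction onto it given by the universal property agrees with
   the identity by uniqueness. *)
Lemma free_normal_closure_ind (S : {pred C}) :
    group_closed S -> (forall a g, a \in S -> act a g \in S) ->
    (forall x, c x \in S) ->
  forall a, a \in S.
Proof.
move=> closedS actS cS.
pose M := subgroup_type closedS.
pose psi x : M := exist _ (c x) (cS x).
have psiM : {morph psi : x y / x * y}.
  by move=> x y; apply: val_inj; rewrite valM /= gmulfM.
pose psi' : {multiplicative Gamma -> M} :=
  HB.pack psi (isMultiplicative.Build Gamma M psi psiM).
pose nM (a : M) := n (val a).
have nMM : {morph nM : x y / x * y}.
  by move=> x y; rewrite /nM valM gmulfM.
pose nM' : {multiplicative M -> G} :=
  HB.pack nM (isMultiplicative.Build M G nM nMM).
pose actM (a : M) g : M := exist _ (act (val a) g) (actS _ g (valP a)).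
have nmM : is_normal_map nM' actM.
  split=> [a|a g h|a b g|a g|a b].
  - apply: val_inj; exact: nm_act1 nm _.
  - apply: val_inj; exact: nm_actM nm _ _ _.
  - apply: val_inj; rewrite [RHS]valM /=.
    rewrite [X in act X g](valM a b). exact: (nm_actMl nm).
  - exact: nm_NM1 nm _ _.
  - apply: val_inj; rewrite [RHS](gmulfJ (val : M -> C)); exact: (nm_NM2 nm).
have factM x : nM' (psi' x) = phi x := fnc_factor fnc x.
have [r [[rn ract] rc _]] := fnc_univ fnc nmM factM.
have [r0 [_ _ uniq_r0]] := fnc_univ fnc nm (fnc_factor fnc).
pose valr : {multiplicative C -> C} := (val : M -> C) \o r.
have er : valr =1 r0.
  apply: uniq_r0 => [|x]; last by rewrite /= rc.
  by split=> [a|a g] /=; rewrite -?rn ?ract.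
have ei : idfun =1 r0 by exact: uniq_r0.
by move=> a; rewrite -[a]/(idfun a) ei -er; apply: valP.
Qed.
End FreeNormalClosure.

(** Finiteness as a proposition, since the groups of the tower come without a finite structure. *)
Definition finitely_enumerable (H : eqType) :=
  exists s : seq H, forall x, x \in s.

(** Words without inverses suffice for a homomorphism [c], as the inverse of [c x] is [c x^-1]. *)
Definition normally_generated (Gamma H : groupType) (c : Gamma -> H) :=
  forall x : H, exists w : seq (Gamma * H), x = \prod_(p <- w) c p.1 ^ p.2.

(* What remains of hypercentrality of the kernel; being elementwise, it makes
   sense before [H] is known to be finite. *)
Definition coprime_central_kernel (H G : groupType) (f : H -> G) :=
  forall (x z : H) k l,
    coprime k l -> x ^+ k = 1 -> z ^+ l = 1 -> f z = 1 -> commute x z.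

(** * One step of the tower *)

Section Step.
Variables (Gamma : finGroupType) (G C : groupType).
Variables (phi : {multiplicative Gamma -> G}).
Variables (c : {multiplicative Gamma -> C}) (n : {multiplicative C -> G}).
Variable act : C -> G -> C.
Hypothesis fnc : is_free_normal_closure phi c n act.
Let nm := fnc_normal fnc.

(** The products of translates of the image form a subgroup stable under the action, hence all of
    [C]; Dietzmann's argument bounds the length of the words. *)
Lemma free_normal_closure_finite :
  finitely_enumerable G -> 
  finitely_enumerable C /\
  forall a : C, exists w : seq (Gamma * G), a = \prod_(p <- w) act (c p.1) p.2.
Proof.
case=> s sG.
pose S := [seq act (c x) g | x <- enum Gamma, g <- s].
have memS a : reflect (exists p : Gamma * G, a = act (c p.1) p.2) (a \in S).
  apply: (iffP allpairsP) => [[p [_ _ ->]]|[p ->]]; first by exists p.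
  by exists p; rewrite mem_enum sG.
have SJ : {in S &, forall a b, a ^ b \in S}.
  move=> _ _ /memS[[x g] ->] /memS[[y h] ->]; apply/memS.
  by exists (x, g * n (c y) ^ h); rewrite /= (act_conjg nm).
have Sexp a : a \in S -> exists v,
    [/\ {subset v <= S}, size v < #|Gamma| & \prod_(y <- v) y = a ^+ #|Gamma|].
  (* The empty word works: the exponent of a translate divides the order of [Gamma]. *)
  case/memS=> p ->; exists [::]; split=> //; first by apply/card_gt0P; exists 1.
  rewrite big_nil -(actXg nm). rewrite -multiplicativeX.
  by rewrite -cardsT expg_cardG ?inE // multiplicative1 (act1g nm).
pose E := word_products S (#|Gamma| * size S).
have memE a :
    reflect (exists2 w, {subset w <= S} & a = \prod_(y <- w) y) (a \in E).
  apply: (iffP idP) => [/word_productsP // | [w sWS ->]].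
  have [w' [sW'S szw' <-]] := Dietzmann_shorten SJ Sexp sWS.
  exact: mem_word_products.
have EC a : a \in E.
  apply: (free_normal_closure_ind fnc).
  - split=> [|a1 a2]; first by apply/memE; exists [::]; rewrite ?big_nil.
    case/memE=> w1 sW1S -> /memE[w2 sW2S ->]; apply/memE.
    exists (w1 ++ rev [seq y^-1 | y <- w2]).
      move=> z; rewrite mem_cat mem_rev => /orP[/sW1S // | /mapP[y /sW2S]].
      case/memS=> [[x g] ->] ->; apply/memS; exists (x^-1, g).
      by rewrite /= multiplicativeV (actVg nm).
    by rewrite big_cat -map_rev big_map prodgV revK.
  - move=> a1 g /memE[w sWS ->]; apply/memE; exists [seq act y g | y <- w].
      move=> z /mapP[y /sWS/memS[[x h] ->] ->]; apply/memS.
      by exists (x, h * g); rewrite /= (nm_actM nm).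
    by rewrite (act_prodg nm) big_map.
  - move=> x; apply/memE; exists [:: c x]; last by rewrite big_seq1.
    move=> y; rewrite inE => /eqP ->; apply/memS; exists (x, 1).
    by rewrite /= (nm_act1 nm).
split; first by exists E.
move=> a; have /memE[w sWS ->] := EC a; elim: w sWS {a} => [|y w IHw] sWS.
  by exists [::]; rewrite !big_nil.
have /memS[p ep] := sWS y (mem_head y w).
have [|w' IH] := IHw; first by move=> z zw; apply: sWS; rewrite inE zw orbT.
by exists (p :: w'); rewrite !big_cons ep IH.
Qed.

(** The translate [act (c x) g] is sent to [phi x ^ g], and such conjugates generate [G]. *)
Lemma free_normal_closure_surj :
  normally_generated phi -> forall x, exists a, n a = x.
Proof.
move=> gen x; have [w ->] := gen x.
exists (\prod_(p <- w) act (c p.1) p.2); rewrite multiplicative_prod.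
by apply: eq_bigr => p _; rewrite (nm_NM1 nm) (fnc_factor fnc).
Qed.

(** Lifting [g] to some [b] in [C] turns the action of [g] into conjugation by [b]. *)
Lemma free_normal_closure_generated :
  finitely_enumerable G -> normally_generated phi -> normally_generated c.
Proof.
move=> finG gen a; have [_ /(_ a)[w ->]] := free_normal_closure_finite finG.
elim: w {a} => [|p w [w' IH]]; first by exists [::]; rewrite !big_nil.
have [b nb] := free_normal_closure_surj gen p.2.
by exists ((p.1, b) :: w'); rewrite !big_cons IH /= -(nm_NM2 nm) nb.
Qed.

(* The commutator [~ x, z] is central, so its [k]-th power is [~ x ^+ k, z] and
   its [l]-th power is [~ x, z ^+ l]. *)
Lemma free_normal_closure_coprime (G0 : groupType)
    (f : {multiplicative G -> G0}) :
  coprime_central_kernel f -> coprime_central_kernel (f \o n).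
Proof.
move=> cf x z k l co_kl xk1 zl1 /= fz1.
(* The hypothesis on [f] applies to the images in [G]; so [[~ x, z]] lies in the kernel of [n],
   which is central. *)
have nxz : commute (n x) (n z).
  apply: (cf _ _ k l) => //.
    by rewrite -multiplicativeX xk1 multiplicative1.
  by rewrite -multiplicativeX zl1 multiplicative1.
apply/commgP/eqP; set a := [~ x, z].
have na1 : n a = 1 by rewrite multiplicativeR; apply/eqP/commgP/nxz.
have cza b : commute a b by exact: (normal_map_central_ker nm).
have ak1 : a ^+ k = 1.
  have: (x ^+ k) ^ z = 1 by rewrite xk1 conj1g.
  rewrite conjXg -[x ^ z](mulKVg x) -commgEl expgMn; last exact/commute_sym.
  by rewrite xk1 mul1g.
have al1 : a ^+ l = 1.
  have: (z ^+ l) ^ x = 1 by rewrite zl1 conj1g.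
  rewrite conjXg -[z ^ x](mulKVg z) -commgEl -invgR -/a expgMn; last first.
    exact/commuteV/commute_sym.
  by rewrite zl1 mul1g expVgn => /eqP; rewrite invg_eq1 => /eqP.
exact: expg_coprime_eq1 co_kl ak1 al1.
Qed.
End Step.

(** * Bounding the order of a finite group with hypercentral kernel *)

Section Schur.
Variables (gT : finGroupType) (R Z : {group gT}).
Hypothesis sZZR : Z \subset 'Z(R).

(** Length of the list of products of at most [m.+1 * (m * m)] letters from an alphabet of [m * m]
    commutators. *)
Definition schur_bound m := ((m * m).+1 ^ (m.+1 * (m * m)))%N.

Lemma leq_schur_bound m n : m <= n -> schur_bound m <= schur_bound n.
Proof.
move=> lemn; rewrite /schur_bound.
apply: (@leq_trans ((n * n).+1 ^ (m.+1 * (m * m)))).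
  have [-> // | e_gt0] := posnP (m.+1 * (m * m)).
  by rewrite leq_exp2r // ltnS leq_mul.
have lemn2 : m * m <= n * n by rewrite leq_mul.
by rewrite leq_pexp2l // leq_mul.
Qed.

Let sZR : Z \subset R. Proof. exact: subset_trans sZZR (center_sub R). Qed.
Let cZR x z : x \in R -> z \in Z -> commute z x.
Proof. by move=> Rx /(subsetP sZZR)/centerP[_ /(_ x Rx)]. Qed.

(** A commutator depends only on the cosets of [Z] containing its entries. *)
Lemma card_commg_set_central : #|commg_set R R| <= #|R : Z| * #|R : Z|.
Proof.
pose F (A : {set gT} * {set gT}) := [~ repr A.1, repr A.2].
have sub : commg_set R R \subset F @: setX (rcosets Z R) (rcosets Z R).
  apply/subsetP=> _ /imset2P[x y Rx Ry ->].
  apply/imsetP; exists (Z :* x, Z :* y).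
    by rewrite inE /= -!rcosetE !imset_f.
  rewrite /F /=; case: repr_rcosetP => z Zz; case: repr_rcosetP => t Zt.
  have zty : [~ z, t * y] = 1.
    by apply/eqP/commgP/cZR; rewrite // groupM // (subsetP sZR).
  rewrite commMgJ zty conj1g mul1g commgMJ.
  have -> : [~ x, t] = 1 by apply/eqP/commgP/commute_sym/cZR.
  by rewrite conj1g mulg1.
apply: leq_trans (subset_leq_card sub) _.
by apply: leq_trans (leq_imset_card _ _) _; rewrite cardsX.
Qed.

Lemma expg_index_central x : x \in R -> x ^+ #|R : Z| \in Z.
Proof.
move=> Rx; have nZR : R \subset 'N(Z).
  by apply: cents_norm; apply: centsS sZZR _; rewrite centsC subsetIr.
have Nx := subsetP nZR x Rx.
apply: coset_idr; first exact: groupX.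
by rewrite morphX // -card_quotient // expg_cardG // mem_quotient.
Qed.

(** The final [b] of the first factor [c] is moved across [c ^+ m.+1], which leaves a commutator
    with [b * b]. *)
Lemma commg_expS (a b : gT) m (c := [~ a, b]) :
  commute (c ^+ m.+1) b -> c ^+ m.+2 = [~ a, b * b] * (c ^ b) ^+ m.
Proof.
move=> cb.
have -> : c ^+ m.+2 = a^-1 * b^-1 * a * (b * c ^+ m.+1).
  by rewrite expgS {1}/c commgEl conjgE !mulgA.
by rewrite -cb expgS -conjXg /c /commg /conjg invMg !mulgA !mulgK.
Qed.

(* For [c] a commutator of [R] and [m] the index of [Z], [commg_expS] writes
   [c ^+ m.+1] as a product of [m] commutators, so Dietzmann's argument applies
   to the set of commutators. *)
Theorem Schur_card_der1 : #|R^`(1)| <= schur_bound #|R : Z|.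
Proof.
set m := #|R : Z|; pose S := enum (commg_set R R).
have memS x : (x \in S) = (x \in commg_set R R) by rewrite mem_enum.
have SJ : {in S &, forall x y, x ^ y \in S}.
  move=> u v; rewrite !memS => /imset2P[a b Ra Rb ->] /imset2P[c d Rc Rd ->].
  by rewrite conjRg; apply: imset2_f; rewrite groupJ ?groupR.
have Sm s : s \in S -> exists v,
    [/\ {subset v <= S}, size v < m.+1 & \prod_(y <- v) y = s ^+ m.+1].
  rewrite memS => /imset2P[a b Ra Rb ->].
  have Rc : [~ a, b] \in R by rewrite groupR.
  (* [commg_expS] is used at [m.-1], so that the power assumed to commute with [b] is the [m]-th
     one, which lies in [Z]. *)
  exists ([~ a, b * b] :: nseq m.-1 ([~ a, b] ^ b)).
  have m_gt0 : 0 < m by apply: indexg_gt0.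
  split=> [z||]; last 1 first.
  - rewrite big_cons big_nseq iter_mulg_1 -(prednK m_gt0) commg_expS //.
    by rewrite prednK //; apply/cZR/expg_index_central.
  - rewrite inE mem_nseq memS => /predU1P[-> | /andP[_ /eqP->]].
      by rewrite imset2_f ?groupM.
    by rewrite conjRg imset2_f ?groupJ.
  - by rewrite /= size_nseq prednK.
pose E := word_products S (m.+1 * size S).
have szS : size S <= m * m by rewrite -cardE card_commg_set_central.
apply: (@leq_trans (size E)).
  apply: leq_trans (card_size E); apply/subset_leq_card/subsetP=> x.
  rewrite derg1 => /gen_prodgP[k [f fC ->]].
  have sfS : {subset [seq f i | i <- index_enum 'I_k] <= S}.
    by move=> _ /mapP[i _ ->]; rewrite memS.
  have [w [sWS szw]] := Dietzmann_shorten SJ Sm sfS.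
  rewrite big_map => <-; exact: mem_word_products.
rewrite size_word_products; apply: (@leq_trans ((m * m).+1 ^ (m.+1 * size S))).
  have [-> // | e_gt0] := posnP (m.+1 * size S).
  by rewrite leq_exp2r // ltnS.
by rewrite leq_pexp2l // leq_mul.
Qed.
End Schur.

(** * Residuals and the case of a normal p-subgroup *)

Section CentralPart.
Variables (gT : finGroupType) (pi : nat_pred).
Implicit Types (x z : gT) (H K D : {group gT}).

(* The residual O^pi(H). *)
Definition pi_residual H := <<[set x in H | pi^'.-elt x]>>.
Canonical pi_residual_group H := Eval hnf in [group of pi_residual H].

Lemma mem_pi_residual H x : x \in H -> pi^'.-elt x -> x \in pi_residual H.
Proof. by move=> Hx px; rewrite mem_gen ?inE ?Hx. Qed.

Lemma pi_residual_sub H : pi_residual H \subset H.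
Proof. by rewrite gen_subG; apply/subsetP=> x; rewrite inE => /andP[]. Qed.

Lemma pi_residual_norm H K : K \subset 'N(H) -> K \subset 'N(pi_residual H).
Proof.
move=> nHK; apply/subsetP=> y Ky; apply: (subsetP (norm_gen _)).
apply/normP/setP=> x; rewrite mem_conjg !inE p_eltJ.
by rewrite memJ_norm // groupV (subsetP nHK).
Qed.

Lemma pi_residual_normal H : pi_residual H <| H.
Proof. by rewrite /normal pi_residual_sub pi_residual_norm ?normG. Qed.

Lemma pgroup_elts (G : {group gT}) :
  (forall x, x \in G -> pi.-elt x) -> pi.-group G.
Proof.
move=> piG; apply/pgroupP=> q q_pr /Cauchy[] // x Gx ox.
by have := piG x Gx; rewrite /p_elt ox pnatE.
Qed.

Lemma cent_pi_residual H K :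
    (forall x z, x \in H -> z \in K -> pi^'.-elt x -> commute x z) ->
  K \subset 'C(pi_residual H).
Proof.
move=> cHK; rewrite centsC gen_subG; apply/subsetP=> x.
by rewrite inE => /andP[Hx px]; apply/centP=> z Kz; apply: cHK.
Qed.

End CentralPart.

(** The [pi^']-constituent of an element of [H] lies in the residual and vanishes in the
    quotient. *)
Lemma pi_residual_quotient (gT : finGroupType) (pi : nat_pred)
    (H : {group gT}) :
  pi.-group (H / pi_residual pi H).
Proof.
apply: pgroup_elts => _ /morphimP[x Nx Hx ->].
rewrite /p_elt -pnatNK; apply/constt1P.
rewrite -morph_constt //; apply: coset_id.
by rewrite mem_pi_residual ?groupX ?p_elt_constt.
Qed.

(* [R / R^`(1)] is a [pi^']-group, being abelian and generated by
   [pi^']-elements. *)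
Lemma pi_subgroup_der1 (gT : finGroupType) (pi : nat_pred) (H Z : {group gT})
    (R := pi_residual_group pi H) :
  pi.-group Z -> Z \subset R -> Z \subset R^`(1).
Proof.
move=> piZ sZR.
have nR'R : R \subset 'N(R^`(1)) := der_norm 1 R.
have abRR' : abelian (R / R^`(1)) by apply: der_abelian.
have pi'RR' : pi^'.-group (R / R^`(1)).
  have [O nsO HallO] : exists2 O : {group coset_of R^`(1)},
      O <| R / R^`(1) & pi^'.-Hall(R / R^`(1)) O.
    exists 'O_pi^'(R / R^`(1))%G; first exact: pcore_normal.
    exact: nilpotent_pcore_Hall (abelian_nil abRR').
  apply: pgroupS (pHall_pgroup HallO).
  rewrite {1}/R /= quotient_gen; last first.
    exact: subset_trans (subset_gen _) nR'R.
  rewrite gen_subG; apply/subsetP=> _ /morphimP[x Nx Sx ->].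
  move: Sx; rewrite inE => /andP[Hx pi'x].
  have Qx : coset R^`(1) x \in R / R^`(1).
    by rewrite mem_quotient // mem_pi_residual.
  by rewrite (mem_normal_Hall HallO nsO Qx) morph_p_elt.
(* The image of [Z] is both a [pi]-group and a [pi^']-group, hence trivial. *)
rewrite -quotient_sub1 ?(subset_trans sZR) // subG1 trivg_card1.
rewrite (pnat_1 (quotient_pgroup _ piZ)) //.
exact: pgroupS (quotientS _ sZR) pi'RR'.
Qed.

Lemma quotient_normal_generators (gT : finGroupType) (H N D : {group gT}) :
    H \subset 'N(N) -> D \subset H -> H \subset <<class_support D H>> ->
  H / N \subset <<class_support (D / N) (H / N)>>.
Proof.
move=> nNH sDH /(quotientS N); rewrite quotient_gen; last first.
  by rewrite (subset_trans _ nNH) // class_support_subG.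
move/subset_trans; apply; apply: genS.
apply/subsetP=> _ /morphimP[_ _ /imset2P[x y Dx Hy ->] ->].
have Nx := subsetP nNH x (subsetP sDH x Dx); have Ny := subsetP nNH y Hy.
by rewrite morphJ // imset2_f ?mem_quotient.
Qed.

(** The image of [D] is subnormal in the nilpotent quotient. Were it proper, its normal closure
    would be proper too, so it is the whole quotient. *)
Lemma pi_residual_cover (gT : finGroupType) (p : nat) (H D : {group gT}) :
  D \subset H -> H \subset <<class_support D H>> ->
  #|H : pi_residual p H| <= #|D|.
Proof.
move=> sDH genH; set R := pi_residual p H.
have nRH : H \subset 'N(R) := normal_norm (pi_residual_normal p H).
rewrite -card_quotient //.
have snDH : D / R <|<| H / R.
  apply: nilpotent_subnormal; last exact: quotientS.
  exact: pgroup_nil (pi_residual_quotient p H).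
case: (subnormalEsupport snDH) => [<- | /proper_subn/negP[]].
  exact: leq_quotient.
by have := quotient_normal_generators nRH sDH genH.
Qed.

(* [K :&: R] is central in R = O^p(H) and contained in R^`(1), whose order is
   bounded by Schur's theorem; [K / (K :&: R)] embeds in the p-group H / R, which
   is a quotient of D because a proper subgroup of a p-group lies in a proper
   normal subgroup. *)
Lemma card_normal_pgroup_bound (gT : finGroupType) (p : nat)
    (H K D : {group gT}) :
    K <| H -> p.-group K ->
    (forall x z, x \in H -> z \in K -> p^'.-elt x -> commute x z) ->
    D \subset H -> H \subset <<class_support D H>> ->
  #|K| <= #|D| * schur_bound #|H : K|.
Proof.
move=> nsKH pK cHK sDH genH; have [sKH nKH] := andP nsKH.
set R := pi_residual_group p H; pose Z := (K :&: R)%G.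
have sRH : R \subset H := pi_residual_sub p H.
have sZR : Z \subset R := subsetIr K R.
have cKR : K \subset 'C(R) := cent_pi_residual cHK.
have sZZR : Z \subset 'Z(R) by rewrite subsetI sZR subIset ?cKR.
have sZR' : Z \subset R^`(1).
  by apply: pi_subgroup_der1 (pgroupS _ pK) sZR; apply: subsetIl.
have iKZ : #|K : Z| <= #|D|.
  apply: leq_trans (pi_residual_cover p sDH genH).
  by rewrite indexgI; apply/subset_leq_card/imsetS.
have iRZ : #|R : Z| <= #|H : K|.
  by rewrite /Z /= setIC indexgI; apply/subset_leq_card/imsetS.
rewrite -(Lagrange (subsetIl K R)) mulnC leq_mul //.
apply: leq_trans (subset_leq_card sZR') _.
apply: leq_trans (Schur_card_der1 sZZR) _.
exact: leq_schur_bound.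
Qed.

(* A Sylow p-subgroup of the residual is central, so Schur-Zassenhaus makes it a
   direct factor, which must be trivial. *)
Lemma p'group_pi_residual (gT : finGroupType) (p : nat) (K : {group gT}) :
    (forall x z, x \in K -> z \in K -> p^'.-elt x -> p.-elt z -> commute x z) ->
  p^'.-group (pi_residual p K).
Proof.
move=> cK; set N := pi_residual_group p K.
have sNK : N \subset K := pi_residual_sub p K.
have [P sylP] := Sylow_exists p N.
have [sPN pP _] := and3P sylP.
have cPN : N \subset 'C(P).
  rewrite centsC; apply: cent_pi_residual => x z Kx Pz p'x.
  apply: cK (mem_p_elt pP Pz) => //.
  exact/(subsetP sNK)/(subsetP sPN).
have nsPN : P <| N by rewrite /normal sPN cents_norm.
have /splitsP[C /complP[tiPC defN]] :=
  SchurZassenhaus_split (pHall_Hall sylP) nsPN.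
have sCN : C \subset N by rewrite -defN mulG_subr.
have nsCN : C <| N.
  rewrite /normal sCN -defN mul_subG ?normG // cents_norm // centsC.
  exact: subset_trans cPN.
have HallC : p^'.-Hall(N) C.
  have cardN : #|N| = (#|P| * #|C|)%N by rewrite -defN TI_cardMg.
  rewrite /pHall sCN /pgroup pnatNK -(divgS sCN) cardN mulnK ?cardG_gt0 //.
  have [_ _] := and3P sylP; rewrite -(divgS sPN) cardN mulKn ?cardG_gt0 //.
  by move->; apply: pP.
apply: pgroupS (pHall_pgroup HallC).
rewrite gen_subG; apply/subsetP=> x; rewrite inE => /andP[Kx p'x].
by rewrite (mem_normal_Hall HallC nsCN) // mem_pi_residual.
Qed.

(** * From p-parts to a bound on the whole order *)

Section Bound.
Variables (gT : finGroupType) (H K D : {group gT}).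
Hypotheses (nsKH : K <| H) (sDH : D \subset H).
Hypothesis genH : H \subset <<class_support D H>>.
Hypothesis cHK : forall x z, x \in H -> z \in K ->
  coprime #[x] #[z] -> commute x z.

Definition part_bound d m := (m * (d * schur_bound m))%N.

(** [N] is a normal [p^']-group, so passing to [H / N] keeps the [p]-part of the order and makes the
    image of [K] a [p]-group. *)
Lemma partn_card_bound (p : nat) : #|H|`_p <= part_bound #|D| #|H : K|.
Proof.
pose N := pi_residual_group p K.
have [sKH nKH] := andP nsKH.
have sNK : N \subset K := pi_residual_sub p K.
have cHKp x z : x \in H -> z \in K -> p^'.-elt x -> p.-elt z -> commute x z.
  move=> Hx Kz p'x pz; apply: cHK => //.
  by rewrite coprime_sym (pnat_coprime pz p'x).
have p'N : p^'.-group N.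
  have cKp := fun x z (Kx : x \in K) => cHKp x z (subsetP sKH x Kx).
  exact: p'group_pi_residual cKp.
have nNH : H \subset 'N(N) by apply: pi_residual_norm.
have nsNH : N <| H by rewrite /normal (subset_trans sNK).
have nNK := subset_trans sKH nNH; have nND := subset_trans sDH nNH.
have -> : (#|H|`_p = #|H / N|`_p)%N.
  rewrite -(Lagrange (normal_sub nsNH)) partnM ?cardG_gt0 // part_p'nat //.
  by rewrite mul1n card_quotient.
apply: leq_trans (dvdn_leq _ (dvdn_part p _)) _; first exact: cardG_gt0.
have sKHq := quotientS N sKH.
rewrite -(Lagrange sKHq) mulnC.
have iHK : #|H / N : K / N| = #|H : K|.
  by rewrite index_quotient_eq // subIset // sNK orbT.
rewrite iHK leq_mul //.
have := @card_normal_pgroup_bound _ p (H / N)%G (K / N)%G (D / N)%G.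
rewrite /= iHK => bnd.
apply: leq_trans (bnd _ _ _ _ _) _.
- exact: quotient_normal.
- exact: pi_residual_quotient.
- move=> _ _ /morphimP[x Nx Hx ->] /morphimP[z Nz Kz ->] p'x.
  have pz : p.-elt (coset_morphism N z).
    by apply: mem_p_elt (pi_residual_quotient p K) _; rewrite mem_quotient.
  (* Modulo [N], [x] and [z] agree with their [p^']- and [p]-constituents, which commute already in
     [H]. *)
  rewrite -(constt_p_elt p'x) -(constt_p_elt pz) -!morph_constt //.
  have cxz := cHKp _ _ (groupX _ Hx) (groupX _ Kz)
    (p_elt_constt p^' x) (p_elt_constt p z).
  by rewrite /commute -!morphM ?groupX // cxz.
- exact: quotientS.
- exact: quotient_normal_generators.
by rewrite leq_mul ?leq_quotient.
Qed.

(** A prime divisor [p] of the order is at most the [p]-part, hence at most [b]. So there are at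
    most [b.+1] prime-power factors, each at most [b]. *)
Lemma card_bound (b := part_bound #|D| #|H : K|) : #|H| <= b ^ b.+1.
Proof.
have b_gt0 : 0 < b by apply: leq_trans (partn_card_bound 2).
pose r := primes #|H|.
have sz_r : size r <= b.+1.
  rewrite -(size_iota 0 b.+1) uniq_leq_size ?primes_uniq // => p.
  rewrite mem_primes mem_iota ltnS => /and3P[p_pr H_gt0 p_dvd] /=.
  apply: leq_trans (partn_card_bound p).
  by rewrite dvdn_leq ?part_gt0 // -{1}(part_pnat_id (pnat_id p_pr)) partn_dvd.
apply: leq_trans (leq_pexp2l b_gt0 sz_r).
rewrite [#|H|]prod_prime_decomp ?cardG_gt0 // prime_decompE big_map -/r.
elim: r {sz_r} => [|p r IHr]; first by rewrite big_nil.
by rewrite big_cons expnS leq_mul //= -p_part partn_card_bound.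
Qed.
End Bound.

(** * The tower *)

(** An equality rather than an isomorphism, so that finite group theory applies after
    substitution. *)
Lemma finite_groupType (H : groupType) :
  finitely_enumerable H -> exists F : finGroupType, H = F.
Proof.
case: H => [H cH] /= [s Hs].
pose H' : groupType := HB.pack H cH.
pose u : seq H' := undup s.
have fin_u : Finite.axiom u.
  by move=> x; rewrite count_uniq_mem ?undup_uniq // mem_undup Hs.
have indexK : pcancel (index^~ u) (onth u).
  by move=> x; rewrite onthE (nth_map 1) ?nth_index ?index_mem ?mem_undup.
pose F : finGroupType := HB.pack H cH (isCountable.Build H' indexK)
  (isFinite.Build H' fin_u).
by exists F.
Qed.

(** A relation, because a [groupType] carries no cardinality; [has_card_leq] shows that [k] is
    determined. *)
Definition has_card (H : groupType) k :=
  exists2 F : finGroupType, H = F & #|F| = k.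

Lemma surjective_has_card (H' H : groupType) (f : H' -> H) k' k :
    has_card H' k' -> has_card H k -> (forall x, exists a, f a = x) ->
  k <= k' /\ (k' <= k -> bijective f).
Proof.
case=> F' eH' <- [F eH <-]; subst H' H => surj_f.
have im_f : f @: [set: F'] = [set: F].
  apply/setP=> x; rewrite inE; have [a <-] := surj_f x.
  by rewrite imset_f.
have card_im : #|F| = #|f @: [set: F']| by rewrite im_f cardsT.
split=> [|leF'F]; first by rewrite card_im -cardsT leq_imset_card.
have inj_f : injective f.
  have: #|f @: [set: F']| == #|[set: F']|.
    by rewrite eqn_leq leq_imset_card -card_im cardsT.
  by move/imset_injP=> injf x y; apply: injf; rewrite inE.
by apply: inj_card_bij => //; rewrite card_im -cardsT leq_imset_card.
Qed.

Lemma has_card_leq (H : groupType) k k' :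
  has_card H k -> has_card H k' -> k <= k'.
Proof.
move=> hk hk'; have id_surj x : exists a : H, id a = x by exists x.
by have [] := surjective_has_card hk' hk id_surj.
Qed.

Definition order_bound d m := (part_bound d m ^ (part_bound d m).+1)%N.

Lemma leq_order_bound d d' m m' :
    0 < part_bound d m -> d <= d' -> m <= m' ->
  order_bound d m <= order_bound d' m'.
Proof.
move=> b_gt0 led lem.
have leb : part_bound d m <= part_bound d' m'.
  by rewrite !leq_mul ?leq_schur_bound.
apply: (@leq_trans (part_bound d' m' ^ (part_bound d m).+1)).
  by rewrite leq_exp2r.
by rewrite leq_pexp2l // (leq_trans b_gt0).
Qed.

Lemma has_card_bounded (Gamma G : finGroupType) (H : groupType)
    (c : {multiplicative Gamma -> H}) (f : {multiplicative H -> G}) :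
    finitely_enumerable H -> normally_generated c -> coprime_central_kernel f ->
  exists2 k, has_card H k & k <= order_bound #|Gamma| #|G|.
Proof.
case/finite_groupType=> F eH; subst H => gen_c cc_f.
exists #|F|; first by exists F.
have cM : {in [set: Gamma] &, {morph c : x y / x * y}}.
  by move=> x y _ _; apply: gmulfM.
pose cm := Morphism cM.
have fM : {in [set: F] &, {morph f : x y / x * y}}.
  by move=> x y _ _; apply: gmulfM.
pose fm := Morphism fM.
(* [card_bound] is applied to the image [D] of [Gamma] and the kernel [K] of [f], whose index is at
   most the order of [G]. *)
pose D := (cm @* [set: Gamma])%G; pose K := ('ker fm)%G.
have nsKH : K <| [set: F] := ker_normal fm.
have genH : [set: F] \subset <<class_support D [set: F]>>.
  apply/subsetP=> x _; have [w ->] := gen_c x.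
  apply: group_prod => p _; apply: mem_gen; apply: imset2_f; rewrite ?inE //.
  exact: (mem_morphim cm).
have cK x z : x \in [set: F] -> z \in K -> coprime #[x] #[z] -> commute x z.
  move=> _ Kz co_xz; apply: (cc_f x z _ _ co_xz); rewrite ?expg_order //.
  exact: (mker Kz).
rewrite -cardsT.
have bnd := card_bound nsKH (subsetT D) genH cK.
have b_gt0 := leq_trans (part_gt0 2 _)
  (partn_card_bound nsKH (subsetT D) genH cK 2).
apply: leq_trans bnd _; apply: leq_order_bound => //.
  by rewrite -(cardsT Gamma) leq_morphim.
by have := card_morphim fm [set: F]; rewrite setIid => <-; apply: max_card.
Qed.

Lemma normally_generated_class_support (Gamma G : finGroupType)
    (phi : {multiplicative Gamma -> G}) :
    [set: G] = <<class_support (phi @: [set: Gamma]) [set: G]>> ->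
  normally_generated phi.
Proof.
move=> hG x; have: x \in [set: G] by rewrite inE.
rewrite hG => /gen_prodgP[k [y Sy ->]].
elim: (index_enum _) => [|i r [w IHr]]; first by exists [::]; rewrite !big_nil.
have /imset2P[_ g /imsetP[a _ ->] _ ey] := Sy i.
by exists ((a, g) :: w); rewrite !big_cons IHr ey.
Qed.

Section Tower.
Variables (Gamma G : finGroupType) (phi : {multiplicative Gamma -> G}).
Hypothesis hG : [set: G] = <<class_support (phi @: [set: Gamma]) [set: G]>>.
Variable T : normal_closures_tower phi.

Let Gam := tower_group G (nct_group T).
Let psi := tower_map phi (nct_map T).

(** The homomorphism to [G] built by the induction is the composite of the tower maps, starting from
    the identity, whose kernel is trivial. *)
Lemma tower_invariant i :
  [/\ finitely_enumerable (Gam i), normally_generated (psi i)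
    & exists f : {multiplicative Gam i -> G}, coprime_central_kernel f].
Proof.
elim: i => [|i [fin_i gen_i [f cc_f]]].
  split; first by exists (enum G) => x; rewrite mem_enum.
    exact: normally_generated_class_support.
  by exists idfun => x z k l _ _ _ /= ->; apply: commute1.
have fnc := nct_closure T i; split.
- by have [] := free_normal_closure_finite fnc fin_i.
- exact: free_normal_closure_generated fnc fin_i gen_i.
- exists (f \o nct_bar T i).
  exact: free_normal_closure_coprime fnc _ _ cc_f.
Qed.

Lemma tower_has_card i :
  exists2 k, has_card (Gam i) k & k <= order_bound #|Gamma| #|G|.
Proof.
have [fin_i gen_i [f cc_f]] := tower_invariant i.
exact: has_card_bounded fin_i gen_i cc_f.
Qed.

Lemma tower_bar_surjective i x : exists a, nct_bar T i a = x.
Proof.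
have [_ gen_i _] := tower_invariant i.
exact: free_normal_closure_surj (nct_closure T i) gen_i x.
Qed.

Lemma tower_has_card_mono i j k k' :
  i <= j -> has_card (Gam i) k -> has_card (Gam j) k' -> k <= k'.
Proof.
elim: j k' => [|j IHj] k'.
  rewrite leqn0 => /eqP-> hk hk'.
  exact: has_card_leq hk hk'.
rewrite leq_eqVlt => /predU1P[-> | lt_ij] hk hk'.
  exact: has_card_leq hk hk'.
have [l hl _] := tower_has_card j.
apply: leq_trans (IHj l _ hk hl) _ => //.
by have [] := surjective_has_card hk' hl (@tower_bar_surjective j).
Qed.

(** Induction on the slack [d] below the uniform bound: a surjective tower map that is not bijective
    makes the order strictly larger. *)
Lemma tower_stabilizes_from d i k :
    has_card (Gam i) k -> order_bound #|Gamma| #|G| <= k + d ->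
  exists j, forall l, j <= l -> bijective (nct_bar T l).
Proof.
elim: d i k => [|d IHd] i k hk le_b.
  exists i => j le_ij.
  have [kj hkj _] := tower_has_card j.
  have [kj1 hkj1 le1] := tower_has_card j.+1.
  have [_] := surjective_has_card hkj1 hkj (@tower_bar_surjective j); apply.
  rewrite addn0 in le_b; apply: leq_trans le1 (leq_trans le_b _).
  exact: tower_has_card_mono le_ij hk hkj.
have [all_bij | ] := classic (forall l, i <= l -> bijective (nct_bar T l)).
  by exists i.
move=> /(not_all_ex_not nat)-[j nimp].
have [le_ij nbij] := imply_to_and _ _ nimp.
have [kj hkj _] := tower_has_card j; have [kj1 hkj1 _] := tower_has_card j.+1.
apply: (IHd _ _ hkj1); apply: leq_trans le_b _.
rewrite addnS -addSn leq_add2r.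
have le_kkj := tower_has_card_mono le_ij hk hkj.
apply: leq_ltn_trans le_kkj _; rewrite ltnNge; apply/negP=> le_kj.
apply: nbij; have [_] := surjective_has_card hkj1 hkj (@tower_bar_surjective j).
exact.
Qed.
End Tower.

Theorem theorem1p7 (Gamma G : finGroupType) (phi : {multiplicative Gamma -> G})
    (hG : [set: G] = <<class_support (phi @: [set: Gamma]) [set: G]>>)
    (T : normal_closures_tower phi) :
  exists k : nat, forall i : nat, (k <= i)%N -> bijective (nct_bar T i).
Proof.
have [k hk _] := tower_has_card hG T 0.
(* The whole order bound serves as the initial slack. *)
exact: (tower_stabilizes_from hG hk (leq_addl _ _)).
Qed.
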